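(* Let $\rho\in(-1,1)$ with $|\rho|\in(0,1)$, and let $a\in\mathbb{R}$ with $a\neq 1$ and $-1<a\rho<1$. Suppose $\mu_1=\mu_2=0$, $a_{11}=a_{22}=1$ and $a_{12}=a$ (only the correlation changes). If $a>-1$, then the sensitivities $H_1$ and $H_2$ of the two projections (as defined in the context) satisfy $H_2>H_1$.
   Context: Bivariate change setting. The pre-change mean is $\boldsymbol{\mu}_0=\mathbf 0\in\mathbb{R}^2$ and the post-change mean is $\boldsymbol{\mu}_1=(\mu_1,\mu_2)^\top$. The pre- and post-change covariance matrices are $$\boldsymbol{\Sigma}_0=\begin{pmatrix}1&\rho\\ \rho&1\end{pmatrix},\qquad \boldsymbol{\Sigma}_1=\begin{pmatrix}a_{11}^2& a_{11}a_{22}a_{12}\rho\\ a_{11}a_{22}a_{12}\rho& a_{22}^2\end{pmatrix},$$ where $-1<\rho<1$, $\rho\neq 0$, $-1<a_{12}\rho<1$; $a_{11},a_{22}>0$ are multiplicative change factors of the standard deviations and $a_{12}$ is the multiplicative change factor of the correlation. Let $(\lambda_j,\mathbf v_j)_{j=1,2}$ be the eigenvalues and normalized (unit) eigenvectors of $\boldsymbol{\Sigma}_0$, ordered so that $\lambda_1\ge\lambda_2$ (since $\rho\ne0$ the eigenvalues are distinct, so $\mathbf v_j$ is unique up to sign, which does not affect the quantities below). For $j=1,2$ let $p_j$ be the density of the normal distribution with mean $\mathbf v_j^\top\boldsymbol{\mu}_0=0$ and variance $\mathbf v_j^\top\boldsymbol{\Sigma}_0\mathbf v_j=\lambda_j$,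 and let $q_j$ be the density of the normal distribution with mean $\mathbf v_j^\top\boldsymbol{\mu}_1$ and variance $\mathbf v_j^\top\boldsymbol{\Sigma}_1\mathbf v_j$. The sensitivity of the $j$-th projection is $H_j=H(p_j,q_j)\ge 0$, where $H$ is the Hellinger distance; for normal densities $p,q$ with means $\xi_1,\xi_2$ and standard deviations $\sigma_1,\sigma_2>0$, $$H^2(p,q)=1-\sqrt{\frac{2\sigma_1\sigma_2}{\sigma_1^2+\sigma_2^2}}\,\exp\left\{-\frac14\,\frac{(\xi_1-\xi_2)^2}{\sigma_1^2+\sigma_2^2}\right\}.$$ *)

(* Defs.v *)
From mathcomp Require Import all_boot all_order all_algebra.
From mathcomp Require Import all_classical all_reals all_analysis.
Set Implicit Arguments.
Unset Strict Implicit.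
Unset Printing Implicit Defensive.
Import Order.TTheory GRing.Theory Num.Theory.
Import numFieldNormedType.Exports.
Local Open Scope ring_scope.

(* Normalized so that the distance between two densities lies in [0, 1]; in
   that case its square is 1 minus the integral of sqrt (p q). *)
Definition hellinger (R : realType) (p q : R -> R) : R :=
  Num.sqrt (2^-1 *
    \int[@lebesgue_measure R]_x (Num.sqrt (p x) - Num.sqrt (q x)) ^+ 2).

(* [normal_pdf] takes a standard deviation, hence the square root. *)
Definition normal_density (R : realType) (mean variance : R) : R -> R :=
  normal_pdf mean (Num.sqrt variance).

Section Bivariate.
Variable R : realType.

Definition dot (v w : 'cV[R]_2) : R := (v^T *m w) 0 0.

Definition quad (v : 'cV[R]_2) (S : 'M[R]_2) : R := (v^T *m S *m v) 0 0.

Definition premean : 'cV[R]_2 := 0.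

Definition postmean (mu1 mu2 : R) : 'cV[R]_2 :=
  \col_(i < 2) (if i == 0 then mu1 else mu2).

Definition Sigma0 (rho : R) : 'M[R]_2 :=
  \matrix_(i < 2, j < 2) (if i == j then 1 else rho).

Definition Sigma1 (rho a11 a22 a12 : R) : 'M[R]_2 :=
  \matrix_(i < 2, j < 2)
    (if i == j then (if i == 0 then a11 ^+ 2 else a22 ^+ 2)
     else a11 * a22 * a12 * rho).

(* The equation on the characteristic polynomial makes [lam1], [lam2] the full
   list of eigenvalues of [S], counted with multiplicity. *)
Definition ordered_unit_eigenpairs (S : 'M[R]_2)
    (lam1 lam2 : R) (v1 v2 : 'cV[R]_2) : Prop :=
  [/\ char_poly S = ('X - lam1%:P) * ('X - lam2%:P),
      lam2 <= lam1,
      S *m v1 = lam1 *: v1 /\ dot v1 v1 = 1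
    & S *m v2 = lam2 *: v2 /\ dot v2 v2 = 1].

Definition sensitivity (rho mu1 mu2 a11 a22 a12 : R) (v : 'cV[R]_2) : R :=
  hellinger
    (normal_density (dot v premean) (quad v (Sigma0 rho)))
    (normal_density (dot v (postmean mu1 mu2))
                    (quad v (Sigma1 rho a11 a22 a12))).

End Bivariate.

(* Main.v *)
Require Import Defs.
From mathcomp Require Import all_boot all_order all_algebra.
From mathcomp Require Import all_classical all_reals all_analysis.
From mathcomp Require Import ring lra.
Import Order.TTheory GRing.Theory Num.Theory.
Local Open Scope ring_scope.

(** Along a unit eigenvector of the pre-change matrix with eigenvalue [l] the
    two variances are [l] and [1 + a (l - 1)], and the means agree.  Hence the
    squared distance is [1 - sqrt A] with
    [A^2 = 4 l l' / (l + l')^2], where [l' = 1 + a (l - 1)].  With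
    [r = |rho|] the eigenvalues are [1 + r] and [1 - r], and clearing
    denominators in [A_1^2 > A_2^2] leaves the difference
    [2 (1 + a) (1 - a)^2 r^3], which is positive. *)

(** The exponents of two Gaussians with a common mean add up, and half of [1/x + 1/y] is the inverse
    of the harmonic mean of the variances. The constant is what remains of the two peaks. *)
Lemma sqrt_normal_pdfM (R : realType) (m x y t : R) : 0 < x -> 0 < y ->
  Num.sqrt (normal_density m x t) * Num.sqrt (normal_density m y t) =
  Num.sqrt (2 * (Num.sqrt x * Num.sqrt y) / (x + y)) *
    normal_density m (2 * x * y / (x + y)) t.
Proof.
move=> x0 y0.
have xy0 : 0 < x + y by rewrite addr_gt0.
have z0 : 0 < 2 * x * y / (x + y) by rewrite divr_gt0 ?mulr_gt0.
rewrite -sqrtrM; last exact: normal_pdf_ge0.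
rewrite /normal_density !normal_pdfE ?gt_eqF ?sqrtr_gt0// /normal_peak /normal_fun.
rewrite !sqr_sqrtr ?(ltW z0) ?(ltW x0) ?(ltW y0)//.
set z := 2 * x * y / (x + y) in z0 *.
have e : expR (- (t - m) ^+ 2 / (x *+ 2)) * expR (- (t - m) ^+ 2 / (y *+ 2))
   = expR (- (t - m) ^+ 2 / (z *+ 2)) ^+ 2.
  rewrite -expRD [RHS]expr2 -expRD; congr expR; rewrite /z; field.
  by rewrite !gt_eqF.
have p0 : 0 < pi *+ 2 :> R by rewrite mulrn_wgt0// pi_gt0.
rewrite mulrACA e sqrtrM; last by rewrite mulr_ge0 ?invr_ge0 ?sqrtr_ge0.
rewrite sqrtr_sqr ger0_norm ?expR_ge0// [RHS]mulrA -!(mulrnAr _ pi); congr (_ * _).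
rewrite -(sqrtrV (ltW (mulr_gt0 z0 p0))).
rewrite -sqrtrM; last by rewrite ltW ?divr_gt0 ?mulr_gt0 ?sqrtr_gt0.
rewrite !(sqrtrM (pi *+ 2)) ?ltW//; congr Num.sqrt.
(* Writing [x], [y] and [pi *+ 2] as squares of their roots makes the identity rational in these
   roots. *)
have xE := sqr_sqrtr (ltW x0); have yE := sqr_sqrtr (ltW y0).
have pE := sqr_sqrtr (ltW p0); rewrite /z -xE -yE -pE !sqrtr_sqr !ger0_norm//.
by field; rewrite xE yE !gt_eqF ?sqrtr_gt0.
Qed.

(** Expand the square under the integral: both square terms integrate to 1, and the cross term is a
    constant multiple of a normal density, so it integrates to that constant. *)
Lemma hellinger_normal (R : realType) (m x y : R) : 0 < x -> 0 < y ->
  hellinger (normal_density m x) (normal_density m y) =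
  Num.sqrt (1 - Num.sqrt (2 * (Num.sqrt x * Num.sqrt y) / (x + y))).
Proof.
move=> x0 y0; rewrite /hellinger; congr Num.sqrt.
set c := Num.sqrt (_ / _); set z := 2 * x * y / (x + y).
have int v : (@lebesgue_measure R).-integrable setT (EFin \o normal_density m v).
  exact: integrable_normal_pdf.
have int1 v : \int[@lebesgue_measure R]_t normal_density m v t = 1.
  by rewrite /Rintegral integral_normal_pdf.
under eq_Rintegral => t _.
  rewrite sqrrB !sqr_sqrtr ?normal_pdf_ge0// sqrt_normal_pdfM// -/c -/z.
  rewrite addrAC -mulrnAl.
  over.
rewrite RintegralB//=; last 2 first.
- by rewrite (_ : EFin \o _ = (EFin \o normal_density m x) \+
    (EFin \o normal_density m y))%E//; exact: integrableD.
- exact: (integrableZl measurableT (c *+ 2) (int z)).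
by rewrite RintegralD// RintegralZl// !int1; field.
Qed.

Lemma normal_affinity_sqr (R : realType) (x y : R) : 0 < x -> 0 < y ->
  (2 * (Num.sqrt x * Num.sqrt y) / (x + y)) ^+ 2 = 4 * x * y / (x + y) ^+ 2.
Proof.
move=> x0 y0; rewrite !exprMn !sqr_sqrtr ?ltW// exprVn; congr (_ / _); ring.
Qed.

(** The distance decreases in the affinity. Comparing squared affinities removes the roots of the
    variances, which leaves a polynomial condition. *)
Lemma hellinger_normal_lt (R : realType) (m m' x y x' y' : R) :
  0 < x -> 0 < y -> 0 < x' -> 0 < y' ->
  x' * y' * (x + y) ^+ 2 < x * y * (x' + y') ^+ 2 ->
  hellinger (normal_density m x) (normal_density m y) <
  hellinger (normal_density m' x') (normal_density m' y').
Proof.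
move=> x0 y0 x'0 y'0 lt; rewrite !hellinger_normal//.
set A := 2 * _ / (x + y); set B := 2 * _ / (x' + y').
have A0 : 0 < A by rewrite divr_gt0 ?mulr_gt0 ?sqrtr_gt0 ?addr_gt0.
have B0 : 0 < B by rewrite divr_gt0 ?mulr_gt0 ?sqrtr_gt0 ?addr_gt0.
have AB : B < A.
  rewrite -(@ltr_pXn2r _ 2) ?nnegrE ?ltW// !normal_affinity_sqr//.
  rewrite ltr_pdivrMr ?exprn_gt0 ?addr_gt0// [ltRHS]mulrAC.
  rewrite ltr_pdivlMr ?exprn_gt0 ?addr_gt0//.
  lra.
(* With [B < A] this gives [Num.sqrt B < 1], so the larger distance is the root of a positive number
   and the comparison of roots is strict. *)
have A1 : A <= 1.
  rewrite -(@ler_pXn2r _ 2) ?nnegrE ?(ltW A0) // normal_affinity_sqr// expr1n.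
  rewrite ler_pdivrMr ?mul1r; last by rewrite exprn_gt0 ?addr_gt0.
  have := sqr_ge0 (x - y); lra.
have B1 : Num.sqrt B < 1 by rewrite -sqrtr1 ltr_sqrt// (lt_le_trans AB).
by rewrite ltr_sqrt ?subr_gt0// ltrD2l ltrN2 ltr_sqrt.
Qed.

(** Evaluating the characteristic polynomial at 0 and 1 fixes the product and the sum of the
    eigenvalues; their order then decides the sign of [lam1 - 1]. *)
Lemma eigenvalues_Sigma0 (R : realType) (rho lam1 lam2 : R) :
  char_poly (Sigma0 rho) = ('X - lam1%:P) * ('X - lam2%:P) -> lam2 <= lam1 ->
  lam1 = 1 + `|rho| /\ lam2 = 1 - `|rho|.
Proof.
have cE t : (char_poly (Sigma0 rho)).[t] = (t - 1) ^+ 2 - rho ^+ 2.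
  rewrite /char_poly (expand_det_row _ ord0) !big_ord_recl big_ord0 /cofactor.
  rewrite !det_mx11 !mxE/= !hornerE /=; ring.
move=> cp le21; move: (cE 0) (cE 1); rewrite cp !hornerE => e0 e1.
have e : (lam1 - 1) ^+ 2 = `|rho| ^+ 2.
  by rewrite -normrX ger0_norm ?sqr_ge0//; nra.
have r0 := normr_ge0 rho.
have s : lam1 + lam2 = 2 by nra.
have := congr1 Num.sqrt e; rewrite !sqrtr_sqr normr_id ger0_norm; lra.
Qed.

Lemma quad_eigen (R : realType) (S : 'M[R]_2) (lam : R) (v : 'cV[R]_2) :
  S *m v = lam *: v -> dot v v = 1 -> quad v S = lam.
Proof.
by rewrite /quad /dot -mulmxA => -> vv; rewrite -scalemxAr mxE vv mulr1.
Qed.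

(** Being affine in [Sigma0 rho], the post-change matrix has the same eigenvectors. *)
Lemma Sigma1_corrE (R : realType) (rho a : R) :
  Sigma1 rho 1 1 a = a *: Sigma0 rho + (1 - a)%:M.
Proof.
by apply/matrixP => i j; rewrite !mxE; case: eqP => _ /=; rewrite ?if_same; ring.
Qed.

Lemma quad_Sigma1_eigen (R : realType) (rho a lam : R) (v : 'cV[R]_2) :
  Sigma0 rho *m v = lam *: v -> dot v v = 1 ->
  quad v (Sigma1 rho 1 1 a) = 1 + a * (lam - 1).
Proof.
move=> Sv vv; rewrite (_ : 1 + _ = a * lam + (1 - a)); last by ring.
apply: quad_eigen => //.
by rewrite Sigma1_corrE mulmxDl -scalemxAl Sv mul_scalar_mx scalerA scalerDl.
Qed.

Theorem proposition4 (R : realType) (rho a mu1 mu2 a11 a22 a12 : R)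
    (lam1 lam2 : R) (v1 v2 : 'cV[R]_2)
    (hrho : -1 < rho < 1) (hrho0 : 0 < `|rho| < 1)
    (ha1 : a != 1) (harho : -1 < a * rho < 1)
    (hmu1 : mu1 = 0) (hmu2 : mu2 = 0)
    (ha11 : a11 = 1) (ha22 : a22 = 1) (ha12 : a12 = a)
    (heig : ordered_unit_eigenpairs (Sigma0 rho) lam1 lam2 v1 v2)
    (ha : -1 < a) :
  sensitivity rho mu1 mu2 a11 a22 a12 v1 < sensitivity rho mu1 mu2 a11 a22 a12 v2.
Proof.
subst mu1 mu2 a11 a22 a12.
case: heig => cp le21 [Sv1 vv1] [Sv2 vv2].
have [l1 l2] := eigenvalues_Sigma0 _ _ _ _ cp le21.
have post0 : postmean 0 0 = premean R.
  by apply/matrixP => i j; rewrite !mxE if_same.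
rewrite /sensitivity post0 (quad_eigen _ _ _ _ Sv1)// (quad_eigen _ _ _ _ Sv2)//.
rewrite (quad_Sigma1_eigen _ _ _ _ _ Sv1)// (quad_Sigma1_eigen _ _ _ _ _ Sv2)// l1 l2.
(* In terms of [|rho|], the bound on [a * rho] makes both post-change variances, [1 + a r] and
   [1 - a r], positive. *)
have {harho} : `|a * `|rho| | < 1 by rewrite normrM normr_id -normrM ltr_norml.
move: `|rho| hrho0 => r /andP[r0 r1]; rewrite ltr_norml => /andP[ar1 ar2].
apply: hellinger_normal_lt; try lra.
have : 0 < 2 * (1 + a) * (1 - a) ^+ 2 * r ^+ 3.
  have a2 : 0 < (1 - a) ^+ 2 by rewrite exprn_even_gt0//= subr_eq0 eq_sym.
  by rewrite (mulr_gt0 (mulr_gt0 _ a2)) ?exprn_gt0//; lra.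
rewrite -subr_gt0 => h; rewrite -subr_gt0; congr (0 < _): h; ring.
Qed.
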